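(* Let $\mathcal{C}$ be a $(\mathrm{fam},\Sigma)$-category, equipped with its canonical dependent structure $\mathrm{dHom}(a,\lambda):=\mathcal{D}_a\lambda$. For every object $a$ of $\mathcal{C}$ and every $\lambda\in\mathrm{fHom}(a)$ let $$\mathrm{pr}_2^{a,\lambda}\in\mathcal{D}_{\sum_a\lambda}\big(\lambda\circ\mathrm{pr}_1^{a,\lambda}\big)=\Big\{\phi\in\mathrm{Hom}\Big(\sum_a\lambda,\ \sum_{\sum_a\lambda}(\lambda\circ\mathrm{pr}_1^{a,\lambda})\Big)\ \Big|\ \mathrm{pr}_1^{\sum_a\lambda,\,\lambda\circ\mathrm{pr}_1^{a,\lambda}}\circ\phi=1_{\sum_a\lambda}\Big\}$$ be the unique arrow $\sum_a\lambda\to\sum_{\sum_a\lambda}(\lambda\circ\mathrm{pr}_1^{a,\lambda})$ determined, via the pullback square $$\mathrm{pr}_1^{a,\lambda}\circ\Sigma_\lambda\mathrm{pr}_1^{a,\lambda}=\mathrm{pr}_1^{a,\lambda}\circ\mathrm{pr}_1^{\sum_a\lambda,\,\lambda\circ\mathrm{pr}_1^{a,\lambda}},$$ by the equations $$\mathrm{pr}_1^{\sum_a\lambda,\,\lambda\circ\mathrm{pr}_1^{a,\lambda}}\circ\mathrm{pr}_2^{a,\lambda}=1_{\sum_a\lambda}\quad\text{and}\quad\big(\Sigma_\lambda\mathrm{pr}_1^{a,\lambda}\big)\circ\mathrm{pr}_2^{a,\lambda}=1_{\sum_a\lambda}.$$ Then $\mathcal{C}$ becomes a $(\mathrm{dep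},\Sigma)$-category.
   Context: A category $\mathcal{C}$ (with objects $C_0$ and arrows $C_1$) is a fam-category if: (a) every object $a$ has an associated collection $\mathrm{fHom}(a)$ of ''family-arrows''; (b) for all objects $a,b$ there is an operation $\mathrm{fHom}(a)\times \mathrm{Hom}(b,a)\to \mathrm{fHom}(b)$, $(\lambda,f)\mapsto \lambda\circ f$, with $\lambda\circ 1_a=\lambda$ and $\lambda\circ(f\circ g)=(\lambda\circ f)\circ g$ for all $\lambda\in\mathrm{fHom}(a)$, $f\in\mathrm{Hom}(b,a)$, $g\in\mathrm{Hom}(c,b)$. A $(\mathrm{fam},\Sigma)$-category is a fam-category $\mathcal{C}$ equipped with: for every object $a$ and $\lambda\in\mathrm{fHom}(a)$, an object $\sum_a\lambda$ and an arrow $\mathrm{pr}_1^{a,\lambda}\colon\sum_a\lambda\to a$; and for every $f\in\mathrm{Hom}(b,a)$ and $\lambda\in\mathrm{fHom}(a)$, an arrow $\Sigma_\lambda f\colon\sum_b(\lambda\circ f)\to\sum_a\lambda$ such that the commutative square $\mathrm{pr}_1^{a,\lambda}\circ\Sigma_\lambda f=f\circ\mathrm{pr}_1^{b,\lambda\circ f}$ is a pullback (of $\mathrm{pr}_1^{a,\lambda}$ along $f$), and the following strictness conditions hold: $\Sigma_\lambda 1_a=1_{\sum_a\lambda}$, and $\Sigma_\lambda(f\circ g)=(\Sigma_\lambda f)\circ\Sigma_{(\lambda\circ f)}g$ for all $f\in\mathrm{Hom}(b,a)$, $g\in\mathrm{Hom}(c,b)$. A dep-category is a fam-category $\mathcal{C}$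 equipped with: for every object $a$ and $\lambda\in\mathrm{fHom}(a)$, a collection $\mathrm{dHom}(a,\lambda)$ of ''dependent arrows''; and for every $\Phi\in\mathrm{dHom}(a,\lambda)$ and $f\in\mathrm{Hom}(b,a)$, a dependent arrow $\Phi(f)\in\mathrm{dHom}(b,\lambda\circ f)$, called the application of $\Phi$ to $f$, such that $(\mathrm{dep}_1)$ $\Phi(1_a)=\Phi$, and $(\mathrm{dep}_2)$ $\Phi(f\circ g)=[\Phi(f)](g)$ for all $f\in\mathrm{Hom}(b,a)$ and $g\in\mathrm{Hom}(c,b)$. Canonical dependent structure of a $(\mathrm{fam},\Sigma)$-category: $\mathrm{dHom}(a,\lambda):=\mathcal{D}_a\lambda:=\{\phi\in\mathrm{Hom}(a,\sum_a\lambda)\mid\mathrm{pr}_1^{a,\lambda}\circ\phi=1_a\}$, and for $\phi\in\mathcal{D}_a\lambda$, $f\in\mathrm{Hom}(b,a)$, the application $\phi(f)\in\mathcal{D}_b(\lambda\circ f)$ is the unique arrow $b\to\sum_b(\lambda\circ f)$ with $(\Sigma_\lambda f)\circ\phi(f)=\phi\circ f$ and $\mathrm{pr}_1^{b,\lambda\circ f}\circ\phi(f)=1_b$. A $(\mathrm{dep},\Sigma)$-category is a dep-category $\mathcal{C}$ together with operations $\sum_a$, $\mathrm{pr}_1^{a}$, $\Sigma f$ making it a $(\mathrm{fam},\Sigma)$-category, and, for every object $a$ and $\lambda\in\mathrm{fHom}(a)$, a dependent arrow $\mathrm{pr}_2^{a,\lambda}\in\mathrm{dHom}\big(\sum_a\lambda,\lambda\circ\mathrm{pr}_1^{a,\lambda}\big)$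 (the second-projection-dependent arrow) such that for every object $b$ and $f\in\mathrm{Hom}(b,a)$ $$\mathrm{pr}_2^{b,\lambda\circ f}=\mathrm{pr}_2^{a,\lambda}\big(\Sigma_\lambda f\big),$$ where the right-hand side is the application of $\mathrm{pr}_2^{a,\lambda}$ to the arrow $\Sigma_\lambda f$. *)

(* Defs.v *)
(* Categories are given by types of objects and arrows, with Leibniz equality
   of arrows and of family-arrows.  A strictness equation whose two sides have
   types that agree only up to a law of the fam-category is stated by
   transporting one side along (the proof of) that law. *)
From Stdlib Require Import ClassicalEpsilon.

Set Implicit Arguments.
Unset Strict Implicit.
Unset Printing Implicit Defensive.

Reserved Notation "f \o g" (at level 40, left associativity).
Reserved Notation "l \of f" (at level 40, left associativity).

Record category := Category {
  obj :> Type;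
  Hom : obj -> obj -> Type;
  idm : forall a, Hom a a;
  comp : forall a b c, Hom b a -> Hom c b -> Hom c a;
  comp_id_l : forall a b (f : Hom b a), comp (idm a) f = f;
  comp_id_r : forall a b (f : Hom b a), comp f (idm b) = f;
  comp_assoc : forall a b c d (f : Hom b a) (g : Hom c b) (h : Hom d c),
    comp f (comp g h) = comp (comp f g) h
}.

Arguments Hom {_} _ _.
Arguments idm {_} _.

Notation "f \o g" := (comp f g).

(* The square  p : P -> X, q : P -> Y, f : X -> Z, g : Y -> Z. *)
Definition is_pullback (C : category) (P X Y Z : C)
    (p : Hom P X) (q : Hom P Y) (f : Hom X Z) (g : Hom Y Z) : Prop :=
  f \o p = g \o q /\
  forall (T : C) (h : Hom T X) (k : Hom T Y), f \o h = g \o k ->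
    exists! u : Hom T P, p \o u = h /\ q \o u = k.

Record fam_category := FamCategory {
  fam_cat :> category;
  fHom : fam_cat -> Type;
  fcomp : forall a b : fam_cat, fHom a -> Hom b a -> fHom b;
  fcomp_id : forall (a : fam_cat) (l : fHom a), fcomp l (idm a) = l;
  fcomp_comp : forall (a b c : fam_cat) (l : fHom a)
      (f : Hom b a) (g : Hom c b),
    fcomp l (f \o g) = fcomp (fcomp l f) g
}.

Arguments fHom {_} _.

Notation "l \of f" := (fcomp l f).

Record fam_sigma_category := FamSigmaCategory {
  fsig_fam :> fam_category;
  Sig : forall a : fsig_fam, fHom a -> fsig_fam;
  pr1 : forall (a : fsig_fam) (l : fHom a), Hom (Sig l) a;
  Sig_map : forall (a b : fsig_fam) (l : fHom a) (f : Hom b a),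
    Hom (Sig (l \of f)) (Sig l);
  Sig_pullback : forall (a b : fsig_fam) (l : fHom a) (f : Hom b a),
    is_pullback (Sig_map l f) (pr1 (l \of f)) (pr1 l) f;
  Sig_map_id : forall (a : fsig_fam) (l : fHom a),
    eq_rect (l \of idm a) (fun m => Hom (Sig m) (Sig l))
      (Sig_map l (idm a)) l (fcomp_id l)
    = idm (Sig l);
  Sig_map_comp : forall (a b c : fsig_fam) (l : fHom a)
      (f : Hom b a) (g : Hom c b),
    eq_rect (l \of (f \o g)) (fun m => Hom (Sig m) (Sig l))
      (Sig_map l (f \o g)) ((l \of f) \of g) (fcomp_comp l f g)
    = Sig_map l f \o Sig_map (l \of f) g
}.

Record dep_data (C : fam_category) := DepData {
  dHom : forall a : C, fHom a -> Type;
  dapp : forall (a b : C) (l : fHom a),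
    dHom l -> forall f : Hom b a, dHom (l \of f)
}.

Definition dcast (C : fam_category) (D : dep_data C) (a : C) (l m : fHom a)
    (e : l = m) (Phi : dHom D l) : dHom D m :=
  eq_rect l (fun n => dHom D n) Phi m e.

Record is_dep_category (C : fam_category) (D : dep_data C) : Prop :=
  IsDepCategory {
  dep1 : forall (a : C) (l : fHom a) (Phi : dHom D l),
    dcast (fcomp_id l) (dapp Phi (idm a)) = Phi;
  dep2 : forall (a b c : C) (l : fHom a) (Phi : dHom D l)
      (f : Hom b a) (g : Hom c b),
    dcast (fcomp_comp l f g) (dapp Phi (f \o g)) = dapp (dapp Phi f) g
}.

Lemma fcomp_square (C : fam_sigma_category) (a b : C) (l : fHom a)
    (f : Hom b a) :
  (l \of pr1 l) \of Sig_map l f = (l \of f) \of pr1 (l \of f).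
Proof.
  rewrite <- !fcomp_comp.
  exact (f_equal (fcomp l) (proj1 (Sig_pullback l f))).
Qed.

(* The (fam,Sigma)-laws are already part of [C]. *)
Record is_dep_sigma_category (C : fam_sigma_category) (D : dep_data C)
    (pr2 : forall (a : C) (l : fHom a), dHom D (l \of pr1 l)) : Prop :=
  IsDepSigmaCategory {
  dep_sigma_dep : is_dep_category D;
  pr2_natural : forall (a b : C) (l : fHom a) (f : Hom b a),
    pr2 b (l \of f) = dcast (fcomp_square l f) (dapp (pr2 a l) (Sig_map l f))
}.

Definition section (C : fam_sigma_category) (a : C) (l : fHom a) : Type :=
  {phi : Hom a (Sig l) | pr1 l \o phi = idm a}.

Definition section_arrow (C : fam_sigma_category) (a : C) (l : fHom a)
    (phi : section l) : Hom a (Sig l) := proj1_sig phi.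

Lemma section_app_exists (C : fam_sigma_category) (a b : C) (l : fHom a)
    (phi : section l) (f : Hom b a) :
  exists! psi : Hom b (Sig (l \of f)),
    Sig_map l f \o psi = section_arrow phi \o f /\
    pr1 (l \of f) \o psi = idm b.
Proof.
  apply (proj2 (Sig_pullback l f)).
  unfold section_arrow.
  rewrite comp_assoc, (proj2_sig phi), comp_id_l, comp_id_r.
  reflexivity.
Qed.

Definition section_app_sig (C : fam_sigma_category) (a b : C) (l : fHom a)
    (phi : section l) (f : Hom b a) :=
  constructive_indefinite_description _ (section_app_exists phi f).

Definition section_app (C : fam_sigma_category) (a b : C) (l : fHom a)
    (phi : section l) (f : Hom b a) : section (l \of f) :=
  let s := section_app_sig phi f in
  exist _ (proj1_sig s) (proj2 (proj1 (proj2_sig s))).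

Definition canonical_dep (C : fam_sigma_category) : dep_data C :=
  DepData (dHom := fun (a : C) (l : fHom a) => section l)
    (fun (a b : C) (l : fHom a) => @section_app C a b l).

(* Main.v *)
(** Two sections of the same family agree once their composites with a
    canonical arrow [Sig_map l f] agree, because that arrow and [pr1] are
    jointly monic; the same holds for a composite of two canonical arrows.
    Strictness of [Sig_map] says that these composites do not see the
    transports, so each law reduces to an equation between composites that
    follows from the defining equations of application and of [pr2]; in the
    naturality of [pr2] both composites equal [Sig_map l f]. *)
Require Import Defs.
From Stdlib Require Import ClassicalEpsilon.

Set Implicit Arguments.
Unset Strict Implicit.

Lemma pullback_jointly_monic (C : category) (P X Y Z : C)
    (p : Hom P X) (q : Hom P Y) (f : Hom X Z) (g : Hom Y Z) :
  is_pullback p q f g ->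
  forall (T : C) (u v : Hom T P), p \o u = p \o v -> q \o u = q \o v -> u = v.
Proof.
  intros [Hsq Huniv] T u v Hp Hq.
  destruct (Huniv T (p \o u) (q \o u)) as [w [_ Hw]].
  - now rewrite !comp_assoc, Hsq.
  - transitivity w; [symmetry|]; apply Hw; split; auto.
Qed.

Section Sections.

Variable C : fam_sigma_category.
Implicit Types a b c : C.

Lemma section_arrow_inj a (l : fHom a) (phi psi : section l) :
  section_arrow phi = section_arrow psi -> phi = psi.
Proof.
  destruct phi as [x Hx], psi as [y Hy]; simpl; intros <-.
  now rewrite (proof_irrelevance _ Hx Hy).
Qed.

Lemma section_arrowK a (l : fHom a) (phi : section l) :
  pr1 l \o section_arrow phi = idm a.
Proof. exact (proj2_sig phi). Qed.

Lemma pr1_Sig_map a b (l : fHom a) (f : Hom b a) :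
  pr1 l \o Sig_map l f = f \o pr1 (l \of f).
Proof. exact (proj1 (Sig_pullback l f)). Qed.

Lemma Sig_map_dapp a b (l : fHom a) (phi : dHom (canonical_dep C) l)
    (f : Hom b a) :
  Sig_map l f \o section_arrow (dapp phi f) = section_arrow phi \o f.
Proof. exact (proj1 (proj1 (proj2_sig (section_app_sig phi f)))). Qed.

Lemma section_eq_comp a b c (l : fHom a) (f : Hom b a) (g : Hom c b)
    (phi psi : section ((l \of f) \of g)) :
  Sig_map l f \o (Sig_map (l \of f) g \o section_arrow phi)
  = Sig_map l f \o (Sig_map (l \of f) g \o section_arrow psi) ->
  phi = psi.
Proof.
  intros H.
  apply section_arrow_inj.
  apply (pullback_jointly_monic (Sig_pullback (l \of f) g)).
  - apply (pullback_jointly_monic (Sig_pullback l f)); [exact H|].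
    (* Followed by [pr1 (l \of f)], both inner composites equal [g]. *)
    now rewrite !comp_assoc, pr1_Sig_map, <- !comp_assoc, !section_arrowK.
  - now rewrite !section_arrowK.
Qed.

(** The two transports cancel. The endpoint [m] is kept a variable so that [e] can be eliminated,
    which is impossible for [fcomp_id l] itself. *)
Lemma comp_section_dcast a b (l m : fHom a) (e : l = m)
    (k : Hom (Sig l) b) (phi : section l) :
  eq_rect l (fun n => Hom (Sig n) b) k m e
    \o section_arrow (dcast (D := canonical_dep C) e phi)
  = k \o section_arrow phi.
Proof. now destruct e. Qed.

(** Replacing [f] by [g] under a transport would be ill-typed, since [e] mentions [f]. Taking [e']
    separately avoids this: once the arrows are identified, proof irrelevance identifies the two
    proofs. *)
Lemma Sig_map_cast_eq a b (l : fHom a) (f g : Hom b a) (m : fHom b)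
    (e : l \of f = m) (e' : l \of g = m) :
  f = g ->
  eq_rect (l \of f) (fun n => Hom (Sig n) (Sig l)) (Sig_map l f) m e
  = eq_rect (l \of g) (fun n => Hom (Sig n) (Sig l)) (Sig_map l g) m e'.
Proof. now intros <-; rewrite (proof_irrelevance _ e e'). Qed.

Lemma Sig_map_comp_dcast a b c (l : fHom a) (f : Hom b a) (g : Hom c b)
    (phi : section (l \of (f \o g))) :
  Sig_map l f \o (Sig_map (l \of f) g
    \o section_arrow (dcast (D := canonical_dep C) (fcomp_comp l f g) phi))
  = Sig_map l (f \o g) \o section_arrow phi.
Proof. rewrite comp_assoc, <- Sig_map_comp; apply comp_section_dcast. Qed.

(** By strictness both double composites are transports of [Sig_map l] at the common arrow
    [f' \o g' = f \o g]. The proof [e] is arbitrary, so how [fcomp_square] was proved is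
    irrelevant. *)
Lemma Sig_map_square_dcast a b b' c (l : fHom a) (f : Hom b a) (g : Hom c b)
    (f' : Hom b' a) (g' : Hom c b')
    (e : (l \of f') \of g' = (l \of f) \of g)
    (phi : section ((l \of f') \of g')) :
  f' \o g' = f \o g ->
  Sig_map l f \o (Sig_map (l \of f) g
    \o section_arrow (dcast (D := canonical_dep C) e phi))
  = Sig_map l f' \o (Sig_map (l \of f') g' \o section_arrow phi).
Proof.
  intros H.
  rewrite !comp_assoc, <- !Sig_map_comp.
  rewrite (Sig_map_cast_eq (fcomp_comp l f g)
             (eq_trans (fcomp_comp l f' g') e) (eq_sym H)).
  destruct e; reflexivity.
Qed.

Lemma canonical_dep_is_dep_category : is_dep_category (canonical_dep C).
Proof.
  split.
  - intros a l phi.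
    apply section_arrow_inj.
    (* The inserted identity is turned into the transported [Sig_map l (idm a)], whose transport
       cancels the [dcast]. *)
    rewrite <- (comp_id_l (section_arrow (dcast (D := canonical_dep C) _ _))).
    rewrite <- Sig_map_id.
    rewrite comp_section_dcast.
    now rewrite Sig_map_dapp, comp_id_r.
  - intros a b c l phi f g.
    apply section_eq_comp.
    (* Both sides become [section_arrow phi \o f \o g]. *)
    rewrite Sig_map_comp_dcast, !Sig_map_dapp, !comp_assoc, Sig_map_dapp.
    reflexivity.
Qed.

(** [Sig (l \of pr1 l)] is the kernel pair of [pr1 l], and the arrow sought is its diagonal, induced
    by two identity legs. *)
Lemma second_projection_exists a (l : fHom a) :
  exists! phi : Hom (Sig l) (Sig (l \of pr1 l)),
    pr1 (l \of pr1 l) \o phi = idm (Sig l) /\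
    Sig_map l (pr1 l) \o phi = idm (Sig l).
Proof.
  destruct (proj2 (Sig_pullback l (pr1 l)) _ (idm (Sig l)) (idm (Sig l))
              eq_refl) as [u [[H1 H2] Hu]].
  exists u; split; [now split|].
  intros v [Hv1 Hv2]; apply Hu; now split.
Qed.

Definition second_projection_sig a (l : fHom a) :=
  constructive_indefinite_description _ (second_projection_exists l).

Definition second_projection a (l : fHom a) : section (l \of pr1 l) :=
  let s := second_projection_sig l in
  exist _ (proj1_sig s) (proj1 (proj1 (proj2_sig s))).

Lemma Sig_map_second_projection a (l : fHom a) :
  Sig_map l (pr1 l) \o section_arrow (second_projection l) = idm (Sig l).
Proof. exact (proj2 (proj1 (proj2_sig (second_projection_sig l)))). Qed.

Lemma second_projection_natural a b (l : fHom a) (f : Hom b a) :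
  second_projection (l \of f)
  = dcast (D := canonical_dep C) (fcomp_square l f)
      (dapp (d := canonical_dep C) (second_projection l) (Sig_map l f)).
Proof.
  apply section_eq_comp.
  (* The commuting square of [Sig_map l f] trades the factorization through [f] for the one through
     [pr1 l], where the application rule for [Sig_map l f] applies. *)
  rewrite Sig_map_square_dcast by apply pr1_Sig_map.
  rewrite Sig_map_second_projection, Sig_map_dapp.
  now rewrite comp_assoc, Sig_map_second_projection, comp_id_l, comp_id_r.
Qed.

End Sections.

Theorem theorem5p4 (C : fam_sigma_category) :
  exists pr2 : forall (a : C) (l : fHom a), section (l \of pr1 l),
    (forall (a : C) (l : fHom a),
       unique (fun phi : Hom (Sig l) (Sig (l \of pr1 l)) =>
                 pr1 (l \of pr1 l) \o phi = idm (Sig l) /\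
                 Sig_map l (pr1 l) \o phi = idm (Sig l))
              (section_arrow (pr2 a l))) /\
    is_dep_sigma_category (D := canonical_dep C) pr2.
Proof.
  exists (@second_projection C); split.
  - intros a l; exact (proj2_sig (second_projection_sig l)).
  - split.
    + apply canonical_dep_is_dep_category.
    + apply second_projection_natural.
Qed.
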